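(* The sets $\mathrm{L}(\omega)$ and $\mathrm{L}(\mathfrak{c})$ are spaceable in $\ell_\infty$. More precisely, $\mathrm{L}(\omega)\cup\{0\}$ contains a linear subspace of $\ell_\infty$ that is linearly isometric to $c_0$, and $\mathrm{L}(\mathfrak{c})\cup\{0\}$ contains a linear subspace of $\ell_\infty$ that is linearly isometric to $\ell_\infty$.
   Context: $\ell_\infty$ is the real Banach space of bounded real sequences $x=(x(n))_{n\in\omega}$ with the supremum norm, where $\omega=\{0,1,2,\dots\}$ (also denoting the smallest infinite cardinal), and $c_0$ is its closed subspace of sequences converging to $0$. $\mathfrak{c}$ is the cardinality of the continuum. For $x\in\ell_\infty$, a real $\eta$ is an accumulation point of $x$ if $\{n\in\omega: |x(n)-\eta|<\varepsilon\}$ is infinite for all $\varepsilon>0$; $\mathrm{L}_x$ denotes the set of accumulation points of $x$. For a cardinal $\kappa$, $\mathrm{L}(\kappa)=\{x\in\ell_\infty: |\mathrm{L}_x|=\kappa\}$. A subset $M$ of a topological vector space $X$ is spaceable in $X$ if $M\cup\{0\}$ contains a closed infinite-dimensional linear subspace of $X$. *)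

(* Defs.v *)
From HB Require Import structures.
From mathcomp Require Import all_boot all_order all_algebra.
From mathcomp Require Import all_classical all_reals all_analysis.

Set Implicit Arguments.
Unset Strict Implicit.
Unset Printing Implicit Defensive.

Import Order.TTheory GRing.Theory Num.Theory.
Import numFieldNormedType.Exports.

Local Open Scope classical_set_scope.
Local Open Scope ring_scope.
Local Open Scope card_scope.

Section Linfty.
Context {R : realType}.

Definition bounded_seq : {pred nat -> R} :=
  mem [set x : nat -> R | bounded_fun x].

Lemma bounded_seqP (x : nat -> R) :
  reflect (exists M, forall n, `|x n| <= M) (x \in bounded_seq).
Proof.
apply: (iffP idP); rewrite in_setE /=.
- by move=> /pinfty_ex_gt0[M _ xM]; exists M => n; exact: xM.
- move=> [M xM]; exists M; split; first exact: num_real.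
  by move=> N MN n _; exact: le_trans (xM n) (ltW MN).
Qed.

Lemma bounded_seq_submod_closed : submod_closed bounded_seq.
Proof.
split.
  by apply/bounded_seqP; exists 0 => n; rewrite normr0.
move=> a x y /bounded_seqP[M xM] /bounded_seqP[N yN].
apply/bounded_seqP; exists (`|a| * M + N) => n.
by rewrite (le_trans (ler_normD _ _))// lerD// normrM ler_wpM2l.
Qed.

HB.instance Definition _ :=
  GRing.isSubmodClosed.Build R (nat -> R) bounded_seq bounded_seq_submod_closed.

End Linfty.

Record linfty (R : realType) := Linfty {
  linfty_seq :> nat -> R;
  linfty_seqP : linfty_seq \in bounded_seq }.

HB.instance Definition _ (R : realType) := [isSub for @linfty_seq R].
HB.instance Definition _ (R : realType) := [Choice of linfty R by <:].
HB.instance Definition _ (R : realType) :=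
  [SubChoice_isSubLmodule of linfty R by <:].

Section LinftyNorm.
Context {R : realType}.
Implicit Types x y : linfty R.

Definition linfty_norm x : R := sup (range (fun n => `|x n|)).

Lemma linfty_norm_has_sup x : has_sup (range (fun n => `|x n|)).
Proof.
split; first by exists `|x 0%N|, 0%N.
have /bounded_seqP[M xM] := linfty_seqP x.
by exists M => _ [n _ <-].
Qed.

Lemma linfty_norm_ge x n : `|x n| <= linfty_norm x.
Proof. by apply: sup_upper_bound; [exact: linfty_norm_has_sup | exists n]. Qed.

Lemma linfty_norm_le x (M : R) :
  (forall n, `|x n| <= M) -> linfty_norm x <= M.
Proof.
move=> xM; apply: ge_sup; first by case: (linfty_norm_has_sup x).
by move=> _ [n _ <-].
Qed.

Lemma linfty_normD x y :
  linfty_norm (x + y) <= linfty_norm x + linfty_norm y.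
Proof.
apply: linfty_norm_le => n.
by rewrite (le_trans (ler_normD _ _))// lerD// linfty_norm_ge.
Qed.

Lemma linfty_normZ (a : R) x : linfty_norm (a *: x) = `|a| * linfty_norm x.
Proof.
have le b z : linfty_norm (b *: z) <= `|b| * linfty_norm z.
  apply: linfty_norm_le => n.
  by rewrite [X in `|X|](_ : _ = b * z n)// normrM ler_wpM2l// linfty_norm_ge.
apply/eqP; rewrite eq_le le/=.
have [->|a0] := eqVneq a 0.
  rewrite normr0 mul0r; exact: le_trans (linfty_norm_ge _ 0%N).
rewrite mulrC -ler_pdivlMr ?normr_gt0// mulrC -normfV.
by rewrite (le_trans _ (le _ _))// scalerA mulVf// scale1r.
Qed.

Lemma linfty_norm0_eq0 x : linfty_norm x = 0 -> x = 0.
Proof.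
move=> x0; apply/val_inj/funext => n.
by apply/eqP; rewrite -normr_le0 -x0 linfty_norm_ge.
Qed.

End LinftyNorm.

HB.instance Definition _ (R : realType) :=
  Lmodule_isNormed.Build R (linfty R)
    linfty_normD linfty_normZ linfty_norm0_eq0.

Lemma linfty_normE (R : realType) (x : linfty R) :
  `|x| = sup (range (fun n => `|x n|)).
Proof. by []. Qed.

Definition c0 (R : realType) : set (linfty R) :=
  [set x : linfty R | (x : nat -> R) @ \oo --> (0 : R)].

Arguments c0 : clear implicits.

Definition accumulation_points (R : realType) (x : nat -> R) : set R :=
  [set eta : R | forall e : R, 0 < e ->
     infinite_set [set n : nat | `|x n - eta| < e]].

(* A cardinal is represented by any set K having it as cardinality. *)
Definition L (R : realType) (T : Type) (K : set T) : set (linfty R) :=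
  [set x : linfty R | accumulation_points x #= K].

Arguments L R {T} K.

Definition linear_subspace (R : numDomainType) (X : lmodType R) (V : set X) :=
  submod_closed (mem V).

Definition finite_dimensional (R : numDomainType) (X : lmodType R)
    (V : set X) :=
  exists (n : nat) (e : 'I_n -> X),
    V = range (fun a : 'I_n -> R => \sum_(i < n) a i *: e i).

Definition spaceable (R : numDomainType) (X : topologicalLmodType R)
    (M : set X) :=
  exists V : set X,
    [/\ linear_subspace V, closed V, ~ finite_dimensional V
      & V `<=` M `|` [set 0]].

(* [V] and [W] are meant to be linear subspaces; only the values on [V] of the
   witness [f] matter. *)
Definition linearly_isometric (R : numDomainType) (X Y : normedModType R)
    (V : set X) (W : set Y) :=
  exists f : X -> Y,
    [/\ forall (a : R) (x y : X), V x -> V y -> f (a *: x + y) = a *: f x + f y,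
        forall x : X, V x -> `|f x| = `|x|
      & f @` V = W].

(* Main.v *)
(* Fix q : nat -> R with |q j| <= 1 for all j and q j0 = 1 for some j0, and send
   y to the sequence taking each value y i * q j infinitely often.  This is a
   linear isometry of linfty into itself; it has a contractive left inverse
   (sampling at j = j0), so images of closed subspaces are closed.
   For q j = 1 / (j + 1) and y in c0, only finitely many values exceed any
   given e > 0 in modulus, so the accumulation points are the values
   y i / (j + 1) and 0.  If q runs through the rationals of [-1, 1] and
   y i != 0, all y i * t with 0 < t < 1 are accumulation points. *)
Require Import Defs.
From mathcomp Require Import all_boot all_order all_algebra.
From mathcomp Require Import all_classical all_reals all_analysis.
From mathcomp Require Import lra.
Local Open Scope classical_set_scope.
Local Open Scope ring_scope.

Set Implicit Arguments.
Unset Strict Implicit.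
Unset Printing Implicit Defensive.

Import Order.TTheory GRing.Theory Num.Theory.
Import numFieldNormedType.Exports.

Local Open Scope card_scope.

Lemma card_le_injective (T U : Type) (f : T -> U) (A : set T) (B : set U) :
  injective f -> (forall x, A x -> B (f x)) -> A #<= B.
Proof.
move=> f_inj AB.
have : f @` A #<= B by apply: subset_card_le => _ [x Ax <-]; exact: AB.
apply: card_le_trans.
by have /card_esym := inj_card_eq (f := f) (A := A) (in2W f_inj);
  rewrite card_eq_le => /andP[].
Qed.

Lemma closed_approx (R : realType) (X : normedModType R) (V : set X) :
  (forall x, (forall e, 0 < e -> exists2 v, V v & `|x - v| < e) -> V x) ->
  closed V.
Proof.
move=> hV x clx; apply: hV => e e0.
have [v [Vv xv]] := clx _ (nbhsx_ballx x e e0).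
by exists v => //; rewrite -ball_normE in xv.
Qed.

(** * Bounded sequences, the space [c0], and accumulation points *)

Section Evaluation.
Context {R : realType}.
Implicit Types x y : linfty R.

Lemma linftyDE x y n : (x + y) n = x n + y n.
Proof. by []. Qed.

Lemma linftyZE a x n : (a *: x) n = a * x n.
Proof. by []. Qed.

Lemma linfty_eval_le x n : `|x n| <= `|x|.
Proof. exact: linfty_norm_ge. Qed.

Lemma linfty_ext x y : (forall n, x n = y n) -> x = y.
Proof. by move=> xy; apply/val_inj/funext. Qed.

Lemma linfty_neq0 x : x != 0 -> exists n, x n != 0.
Proof.
apply: contraNP => /forallNP x0; apply/eqP/linfty_ext => n.
by apply/eqP/negPn/negP; exact: x0.
Qed.

Definition mk_linfty (u : nat -> R) (M : R) (uM : forall n, `|u n| <= M) :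
    linfty R :=
  Linfty (introT (bounded_seqP u) (ex_intro _ M uM)).

Lemma unit_seq_le1 (k n : nat) : `|(n == k)%:R : R| <= 1.
Proof. by case: (n == k); rewrite ?normr1 ?normr0. Qed.

(** These vectors lie in [c0], so they witness infinite dimension both for [c0] and for the whole
    space. *)
Definition unit_seq k : linfty R := mk_linfty (unit_seq_le1 k).

Lemma unit_seq_c0 k : c0 R (unit_seq k).
Proof.
apply/cvgr0Pnorm_lt => e e0; exists k.+1 => // n /= kn.
by rewrite gtn_eqF// normr0.
Qed.

Lemma c0_linear_subspace : linear_subspace (c0 R).
Proof.
split; first by rewrite in_setE; exact: cvg_cst.
move=> a x y; rewrite !in_setE => cx cy.
rewrite /c0 /= -[0](addr0 0) -[X in _ --> X + _](mulr0 a).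
exact: cvgD (cvgM (cvg_cst a) cx) cy.
Qed.

Lemma c0_closed : closed (c0 R).
Proof.
apply: closed_approx => x hx; apply/cvgr0Pnorm_lt => e e0.
have [v /cvgr0Pnorm_lt cv xv] := hx _ (divr_gt0 e0 (ltr0n _ 2)).
have [N _ hN] := cv _ (divr_gt0 e0 (ltr0n _ 2)).
exists N => // n Nn.
rewrite -(subrK (v n) (x n)) (le_lt_trans (ler_normD _ _))//.
rewrite [e]splitr ltrD//; last exact: hN.
exact: le_lt_trans (linfty_eval_le (x - v) n) xv.
Qed.

(** Values close to [eta] have modulus above [|eta| / 2], hence lie in a finite set. Such a set is
    closed, so it contains [eta]. *)
Lemma finite_values_accumulation (x : nat -> R) (eta : R) :
  finite_set [set x n | n in [set n | `|eta| / 2 < `|x n|]] ->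
  eta != 0 -> accumulation_points x eta -> range x eta.
Proof.
set F := (X in finite_set X) => finF eta0 acc.
have cF : closed F
  by apply: accessible_finite_set_closed.1 => //; exact: hausdorff_accessible.
suff: closure F eta.
  by rewrite -(proj1 (closure_id _) cF) => -[n _ <-]; exists n.
move=> B /nbhs_ballP[e /= e0 eB].
(* The bound e keeps [x n] in the given ball; the bound [|eta| / 2] puts it in F. *)
pose d := Num.min e (`|eta| / 2).
have d0 : 0 < d by rewrite lt_min e0 divr_gt0// normr_gt0.
have /infinite_setN0[n /= xn] := acc _ d0.
move: xn; rewrite lt_min => /andP[xe xh].
exists (x n); split; last by apply: eB; rewrite -ball_normE /= distrC.
exists n => //=.
have := ler_normD (x n) (eta - x n); rewrite addrC subrK distrC => h.
by move: xh h; rewrite {1 3}[`|eta|]splitr; lra.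
Qed.

End Evaluation.

(** * The isometric embedding attached to a multiplier sequence [q] *)

Section Spread.
Context {R : realType} (q : nat -> R) (q_le1 : forall j, `|q j| <= 1).

(* Reads [n] as a triple (i, j, m); the idle component [m] makes every pair
   (i, j) occur at infinitely many indices. *)
Definition coordinates (n : nat) : nat * nat :=
  (odflt (0, 0, 0)%N (unpickle n : option (nat * nat * nat))).1.

Lemma coordinates_pickle (i j m : nat) :
  coordinates (pickle (i, j, m)) = (i, j).
Proof. by rewrite /coordinates pickleK. Qed.

Lemma spread_bounded (y : linfty R) n :
  `|y (coordinates n).1 * q (coordinates n).2| <= `|y|.
Proof.
by rewrite normrM -[leRHS]mulr1 ler_pM ?normr_ge0 ?linfty_eval_le.
Qed.

Definition spread (y : linfty R) : linfty R := mk_linfty (spread_bounded y).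

Lemma spreadE y n : spread y n = y (coordinates n).1 * q (coordinates n).2.
Proof. by []. Qed.

Lemma spread_pickle y (i j m : nat) : spread y (pickle (i, j, m)) = y i * q j.
Proof. by rewrite spreadE coordinates_pickle. Qed.

Lemma spread_linear a x y : spread (a *: x + y) = a *: spread x + spread y.
Proof.
by apply: linfty_ext => n; rewrite linftyDE linftyZE !spreadE mulrDl mulrA.
Qed.

(** One j per e suffices: the indices [pickle (i, j, m)], with m varying, all carry the value
    [y i * q j]. *)
Lemma spread_accumulation (y : linfty R) i (eta : R) :
  (forall e, 0 < e -> exists j, `|y i * q j - eta| < e) ->
  accumulation_points (spread y) eta.
Proof.
move=> h e /h[j je].
apply/infiniteP/(@card_le_injective _ _ (fun m : nat => pickle (i, j, m))).
  by move=> m m' /(pcan_inj pickleK)[].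
by move=> m _; rewrite /mkset spread_pickle.
Qed.

Context (j0 : nat) (q_j0 : q j0 = 1).

Lemma sample_bounded (x : linfty R) (i : nat) :
  `|x (pickle (i, j0, 0%N))| <= `|x|.
Proof. exact: linfty_eval_le. Qed.

Definition sample (x : linfty R) : linfty R := mk_linfty (sample_bounded x).

Lemma sampleE (x : linfty R) (i : nat) : sample x i = x (pickle (i, j0, 0%N)).
Proof. by []. Qed.

Lemma sample_linear a x y : sample (a *: x + y) = a *: sample x + sample y.
Proof. exact: linfty_ext. Qed.

Lemma spreadK : cancel spread sample.
Proof.
move=> y; apply: linfty_ext => i.
by rewrite sampleE spread_pickle q_j0 mulr1.
Qed.

(** [spread] is contractive because [|q j| <= 1]; contractivity of its left inverse [sample] gives
    the reverse inequality. *)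
Lemma norm_spread y : `|spread y| = `|y|.
Proof.
apply/eqP; rewrite eq_le; apply/andP; split.
  exact: (@linfty_norm_le _ (spread y) _ (spread_bounded y)).
rewrite -{1}(spreadK y).
exact: (@linfty_norm_le _ (sample _) _ (sample_bounded _)).
Qed.

Lemma spreadB x y : spread (x - y) = spread x - spread y.
Proof. by rewrite addrC -scaleN1r spread_linear scaleN1r addrC. Qed.

Lemma sampleB x y : sample (x - y) = sample x - sample y.
Proof. exact: linfty_ext. Qed.

Lemma norm_sample x : `|sample x| <= `|x|.
Proof. exact: (@linfty_norm_le _ (sample x) _ (sample_bounded x)). Qed.

Lemma spread_image_closed (W : set (linfty R)) :
  closed W -> closed (spread @` W).
Proof.
move=> cW; apply: closed_approx => x hx.
(* If [spread w] is within e of x, then w is within e of [sample x], so [sample x] lies in the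
   closure of W. *)
exists (sample x).
  move: cW => /closure_id ->; move=> B /nbhs_ballP[e /= e0 eB].
  have [_ [w Ww <-] xw] := hx _ e0.
  exists w; split=> //; apply: eB; rewrite -ball_normE /=.
  by rewrite -[w]spreadK -sampleB (le_lt_trans (norm_sample _)).
apply/eqP; rewrite -subr_eq0 -normr_le0; apply/ler_addgt0Pl => e e0.
(* Both x and [spread (sample x)] are within e / 2 of [spread w]. *)
have [_ [w Ww <-] xw] := hx _ (divr_gt0 e0 (ltr0n _ 2)).
rewrite addr0 -(subrK (spread w) (spread _)) -addrA.
rewrite (le_trans (ler_normD _ _))//.
rewrite [e]splitr lerD//; last by rewrite distrC ltW.
rewrite -spreadB norm_spread -[X in _ - X]spreadK -sampleB.
by rewrite (le_trans (norm_sample _))// ltW.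
Qed.

Lemma spread_image_linear (W : set (linfty R)) :
  linear_subspace W -> linear_subspace (spread @` W).
Proof.
move=> [W0 WZD]; split.
  rewrite in_setE; exists 0; first by rewrite in_setE in W0.
  by apply: linfty_ext => n; rewrite spreadE mul0r.
move=> a _ _ /[!in_setE] -[x Wx <-] [y Wy <-].
exists (a *: x + y); last exact: spread_linear.
by have := WZD a x y; rewrite !in_setE; exact.
Qed.

Lemma spread_image_infinite_dimensional (W : set (linfty R)) :
  (forall k, W (unit_seq k)) -> ~ finite_dimensional (spread @` W).
Proof.
move=> Wu [n [e VE]].
have /choice[a ha] : forall k : 'I_n.+1, exists b : 'I_n -> R,
    spread (unit_seq k) = \sum_(i < n) b i *: e i.
  move=> k.
  have : (spread @` W) (spread (unit_seq k)) by exists (unit_seq k).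
  by rewrite VE => -[b _ <-]; exists b.
(* The identity matrix of size n + 1 would factor through dimension n. *)
pose A : 'M[R]_(n.+1, n) := \matrix_(k, i) a k i.
pose E : 'M[R]_(n, n.+1) := \matrix_(i, l) sample (e i) l.
have sumE (I : Type) (r : seq I) (F : I -> linfty R) m :
    (\sum_(i <- r) F i) m = \sum_(i <- r) F i m.
  by elim/big_rec2 : _ => // i x1 x2 _ <-.
have : (1%:M : 'M[R]_n.+1) = A *m E.
  apply/matrixP => k l; rewrite !mxE.
  transitivity (unit_seq (R := R) k l); first by rewrite eq_sym.
  rewrite -[unit_seq _]spreadK ha sampleE sumE; apply: eq_bigr => i _.
  by rewrite !mxE linftyZE.
move=> /(congr1 mxrank); rewrite mxrank1 => rk.
by have := mulmx_max_rank A E; rewrite -rk ltnn.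
Qed.

Lemma spread_image_isometric (W : set (linfty R)) :
  linearly_isometric (spread @` W) W.
Proof.
exists sample; split.
- by move=> a x y _ _; exact: sample_linear.
- by move=> _ [w _ <-]; rewrite spreadK norm_spread.
- rewrite image_comp; apply/seteqP; split=> [_ [w Ww <-]|w Ww] /=.
    by rewrite spreadK.
  by exists w; rewrite //= spreadK.
Qed.

Lemma spread_image_sub (W M : set (linfty R)) :
  (forall y, W y -> y != 0 -> M (spread y)) -> spread @` W `<=` M `|` [set 0].
Proof.
move=> h _ [y Wy <-]; have [->|y0] := eqVneq y 0; last by left; exact: h.
by right; apply: linfty_ext => n; rewrite spreadE mul0r.
Qed.

(** Shared by both cardinals: W is [c0] in the countable case and the whole space in the continuum
    case. *)
Lemma spread_spaceable (W M : set (linfty R)) :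
  linear_subspace W -> closed W -> (forall k, W (unit_seq k)) ->
  (forall y, W y -> y != 0 -> M (spread y)) ->
  spaceable M /\
  exists V : set (linfty R),
    [/\ linear_subspace V, V `<=` M `|` [set 0] & linearly_isometric V W].
Proof.
move=> lW cW uW WM; split; exists (spread @` W); split.
- exact: spread_image_linear.
- exact: spread_image_closed.
- exact: spread_image_infinite_dimensional.
- exact: spread_image_sub.
- exact: spread_image_linear.
- exact: spread_image_sub.
- exact: spread_image_isometric.
Qed.

End Spread.

(** * Countably many accumulation points *)

Section Harmonic.
Context {R : realType}.

Lemma harmonic_le1 j : `|(@harmonic R) j| <= 1.
Proof.
by rewrite ger0_norm ?harmonic_ge0// /harmonic invf_le1 ?ltr0n// ler1n.
Qed.

(** If [y i / (j + 1)] exceeds e in modulus, so do [y i] and [|y| / (j + 1)]; the first bounds i,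
    the second j. *)
Lemma spread_harmonic_finite_values (y : linfty R) (e : R) : c0 R y -> 0 < e ->
  finite_set [set spread harmonic_le1 y n | n in
    [set n | e < `|spread harmonic_le1 y n|]].
Proof.
move=> /cvgr0Pnorm_lt cy e0.
have [N _ hN] := cy _ e0.
have /cvgr0Pnorm_lt ch : (`|y| * (@harmonic R) j) @[j --> \oo] --> (0 : R).
  by rewrite -(mulr0 `|y|); exact: cvgM (cvg_cst _) cvg_harmonic.
have [M _ hM] := ch _ e0.
apply: (sub_finite_set _ (finite_image2 (fun i j => y i * (@harmonic R) j)
  (finite_II N) (finite_II M))) => _ [n + <-].
rewrite /mkset spreadE; move: (coordinates n) => [i j] /= eij.
exists i; last exists j => //.
- rewrite /= ltnNge; apply/negP => /hN; apply/negP; rewrite -leNgt ltW//.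
  by rewrite (lt_le_trans eij)// normrM ler_piMr// harmonic_le1.
- rewrite /= ltnNge; apply/negP => /hM; apply/negP; rewrite -leNgt ltW//.
  by rewrite (lt_le_trans eij)// !normrM normr_id ler_wpM2r// linfty_eval_le.
Qed.

Lemma spread_harmonic_L (y : linfty R) :
  c0 R y -> y != 0 -> L R [set: nat] (spread harmonic_le1 y).
Proof.
move=> cy y0; apply: eq_card_nat.
  (* Index 0 is reserved for the accumulation point 0, which need not be a value of the sequence. *)
  pose g n := if n is m.+1 then spread harmonic_le1 y m else 0.
  apply: (@sub_countable _ _ _ (range g)); last exact: card_image_le.
  apply: subset_card_le => eta acc.
  have [->|eta0] := eqVneq eta 0; first by exists 0%N.
  have [] := finite_values_accumulation _ eta0 acc.
    by apply: spread_harmonic_finite_values => //; rewrite divr_gt0// normr_gt0.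
  by move=> n _ <-; exists n.+1.
(* Conversely, for [y i != 0] the values [y i / (j + 1)] are pairwise distinct accumulation
   points. *)
have [i yi0] := linfty_neq0 y0.
apply/infiniteP/(@card_le_injective _ _ (fun j => y i * (@harmonic R) j)).
  move=> j j' /(mulfI yi0) /invr_inj /eqP.
  by rewrite eqr_nat eqSS => /eqP.
move=> j _; apply: (@spread_accumulation _ _ harmonic_le1 _ i) => e e0.
by exists j; rewrite subrr normr0.
Qed.

End Harmonic.

(** * Continuum many accumulation points *)

Section Dense.
Context {R : realType}.

(** The default 1, for codes of no rational and for rationals outside [-1, 1], keeps the bound valid
    at every index. *)
Definition rationals_in_ball (j : nat) : R :=
  let r := ratr (odflt 1 (unpickle j : option rat)) in
  if `|r| <= 1 then r else 1.

Lemma rationals_in_ball_le1 j : `|rationals_in_ball j| <= 1.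
Proof. by rewrite /rationals_in_ball; case: ifP; rewrite ?normr1. Qed.

Lemma rationals_in_ball_pickle (r : rat) :
  `|ratr r : R| <= 1 -> rationals_in_ball (pickle r) = ratr r.
Proof. by rewrite /rationals_in_ball pickleK /= => ->. Qed.

Lemma rationals_in_ball_dense (t e : R) : 0 < t < 1 -> 0 < e ->
  exists j, `|rationals_in_ball j - t| < e.
Proof.
move=> /andP[t0 t1] e0.
(* Approximating from above but below 1 keeps r in the unit ball. *)
have [r] : exists r : rat, ratr r \in `]t, Num.min 1 (t + e)[.
  by apply: rat_in_itvoo; rewrite lt_min t1 ltrDl.
rewrite in_itv /= lt_min => /and3P[tr r1 rte].
exists (pickle r); rewrite rationals_in_ball_pickle; last first.
  by rewrite ger0_norm; lra.
by rewrite ger0_norm; lra.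
Qed.

Lemma spread_rationals_L (y : linfty R) :
  y != 0 -> L R [set: R] (spread rationals_in_ball_le1 y).
Proof.
move=> y0; rewrite /L /= card_eq_le card_leT /=.
have [i yi0] := linfty_neq0 y0.
(* A logistic function injects the reals into (0, 1); scaling by [y i] lands in the accumulation
   points. *)
apply: (@card_le_injective _ _ (fun r => y i * (1 + expR r)^-1)).
  by move=> r s /(mulfI yi0) /invr_inj /addrI /expR_inj.
move=> r _; apply: (@spread_accumulation _ _ rationals_in_ball_le1 _ i) => e e0.
have [||j hj] := @rationals_in_ball_dense (1 + expR r)^-1 (e / `|y i|).
- have er := expR_gt0 r.
  by rewrite invr_gt0 invf_lt1 ?addr_gt0// ltrDl er.
- by rewrite divr_gt0// normr_gt0.
by exists j; rewrite -mulrBr normrM mulrC -ltr_pdivlMr// normr_gt0.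
Qed.

End Dense.

Theorem theorem4p7 (R : realType) :
  (spaceable (L R [set: nat]) /\ spaceable (L R [set: R])) /\
  (exists V : set (linfty R),
     [/\ linear_subspace V, V `<=` L R [set: nat] `|` [set 0]
       & linearly_isometric V (c0 R)]) /\
  (exists V : set (linfty R),
     [/\ linear_subspace V, V `<=` L R [set: R] `|` [set 0]
       & linearly_isometric V [set: linfty R]]).
Proof.
(* [h0] and [r0] supply the index [j0] at which each multiplier sequence equals 1. *)
have h0 : (@harmonic R) 0%N = 1 := invr1 R.
have r0 : @rationals_in_ball R (pickle (1 : rat)) = 1.
  by rewrite rationals_in_ball_pickle rmorph1// normr1.
have [sN VN] := spread_spaceable h0 c0_linear_subspace c0_closed unit_seq_c0
  spread_harmonic_L.
have lT : linear_subspace [set: linfty R].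
  by split=> [|a x y _ _]; rewrite in_setE.
have [sR VR] := spread_spaceable r0 lT closedT (fun=> I)
  (fun y _ => @spread_rationals_L R y).
by [].
Qed.
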